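(* Let $N,B\ge 1$ be integers. A set $\mathcal{K}$ is a periodic circular sparse ruler of length $NB-1$ and period $N$ if and only if there exists a circular sparse ruler $\mathcal{M}$ of length $N-1$ such that $$\mathcal{K}=\{m+bN:\ m\in\mathcal{M},\ b=0,1,\ldots,B-1\}.$$
   Context: For integers $x$ and $A\ge1$, $(x)_A$ denotes the remainder in $\{0,\ldots,A-1\}$ of $x$ modulo $A$. The $A$-modular difference set of a set $\mathcal{A}$ of integers is $\Delta_A(\mathcal{A})=\{\delta\ge 0:\ \exists a_1,a_2\in\mathcal{A}\text{ such that }\delta=(a_2-a_1)_A\}$. A length-$(L-1)$ circular (or modular) sparse ruler is a set $\mathcal{K}\subset\{0,\ldots,L-1\}$ satisfying $\Delta_L(\mathcal{K})=\{0,\ldots,L-1\}$. A length-$(L-1)$ periodic circular sparse ruler of period $N$, where $N$ divides $L$, is a set $\mathcal{K}\subset\{0,1,\ldots,L-1\}$ satisfying: (1) if $k\in\mathcal{K}$, then $k+bN\in\mathcal{K}$ for all $b\in\mathbb{Z}$ such that $0\le k+bN<L$; (2) $\Delta_L(\mathcal{K})=\{0,1,\ldots,L-1\}$. *)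

(* Defs.v *)
From mathcomp Require Import all_boot all_order all_algebra.
From mathcomp Require Import classical_sets.

Set Implicit Arguments.
Unset Strict Implicit.
Unset Printing Implicit Defensive.

Import Order.TTheory GRing.Theory Num.Theory.
Local Open Scope classical_set_scope.
Local Open Scope ring_scope.

(* The set {0, ..., A - 1}. *)
Definition int_upto (A : int) : set int := [set x | 0 <= x < A].

(* For A >= 1, (x %% A)%Z is the remainder of x in {0, ..., A - 1}, also for
   negative x. *)
Definition modular_difference_set (A : int) (S : set int) : set int :=
  [set d | 0 <= d /\
     exists a1 a2 : int, [/\ S a1, S a2 & d = ((a2 - a1) %% A)%Z]].

(* The parameter L is the modulus: the ruler has length L - 1. *)
Definition circular_sparse_ruler (L : int) (K : set int) : Prop :=
  K `<=` int_upto L /\ modular_difference_set L K = int_upto L.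

(* Again the length is L - 1; N is the period. *)
Definition periodic_circular_sparse_ruler (L N : int) (K : set int) : Prop :=
  [/\ (N %| L)%Z,
      K `<=` int_upto L,
      forall k : int, K k ->
        forall b : int, 0 <= k + b * N < L -> K (k + b * N)
    & modular_difference_set L K = int_upto L].

(* Main.v *)
(* Translates by multiples of N do not change differences modulo N, so the
   residues modulo N of a periodic ruler form a circular ruler, and they are the
   points of the ruler below N. Conversely, a difference d modulo N B is
   m2 - m1 + q N with m1, m2 in M, and q can be taken in {0, ..., B - 1}. *)
Require Import Defs.
From mathcomp Require Import all_boot all_order all_algebra.
From mathcomp Require Import classical_sets.
From mathcomp Require Import zify ring.
Import Order.TTheory GRing.Theory Num.Theory.
Local Open Scope classical_set_scope.
Local Open Scope ring_scope.

Lemma modz_int_upto (A x : int) : 1 <= A -> int_upto A (x %% A)%Z.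
Proof.
move=> hA; apply/andP; split; first by apply: modz_ge0; lia.
by apply: ltz_pmod; lia.
Qed.

Lemma modz_id_upto (A d : int) : int_upto A d -> (d %% A)%Z = d.
Proof. by case/andP=> d0 dA; apply: modz_small; rewrite d0. Qed.

(** Remainders modulo [A] always lie in [int_upto A], so only the covering inclusion has content. *)
Lemma modular_difference_set_full (A : int) (S : set int) : 1 <= A ->
  modular_difference_set A S = int_upto A <->
  forall d, int_upto A d ->
    exists a1 a2 : int, [/\ S a1, S a2 & d = ((a2 - a1) %% A)%Z].
Proof.
move=> hA; split=> [eqA d | full].
  by rewrite -eqA => -[].
apply/seteqP; split=> d.
  by case=> _ [a1 [a2 [_ _ ->]]]; apply: modz_int_upto.
by move=> dA; split; [case/andP: dA | apply: full].
Qed.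

(** As [0 <= m < N], the point [m + b * N] lies in the block from [b * N] up to [(b + 1) * N], so
    [b] alone decides. *)
Lemma int_upto_block (N B m b : int) : int_upto N m ->
  int_upto (N * B) (m + b * N) <-> int_upto B b.
Proof. by rewrite /int_upto /=; nia. Qed.

(** Reduction modulo [N] is a translation by a multiple of [N] that lands below [N <= N * B], so
    periodicity applies. *)
Lemma periodic_modz (N B : int) (K : set int) (k : int) : 1 <= N -> 1 <= B ->
  periodic_circular_sparse_ruler (N * B) N K -> K k -> K (k %% N)%Z.
Proof.
move=> hN hB [_ _ perK _] Kk.
have -> : (k %% N)%Z = k + - (k %/ N)%Z * N by rewrite /modz mulNr.
apply: perK => //; rewrite mulNr -/(modz k N).
by have /andP[] := modz_int_upto N k hN; nia.
Qed.

Lemma circular_of_periodic (N B : int) (K : set int) : 1 <= N -> 1 <= B ->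
  periodic_circular_sparse_ruler (N * B) N K ->
  circular_sparse_ruler N (K `&` int_upto N).
Proof.
move=> hN hB perK; split=> [k [] //|].
have [_ _ _ /modular_difference_set_full fullK] := perK.
apply/modular_difference_set_full => // d dN.
have [||a1 [a2 [Ka1 Ka2 dE]]] := fullK _ d; first by nia.
  by move: dN; rewrite /int_upto /=; nia.
exists (a1 %% N)%Z, (a2 %% N)%Z.
split; try by split; [apply: periodic_modz perK _ | apply: modz_int_upto].
(* Reducing [a1], [a2] and [a2 - a1] subtracts multiples of [N], [N] and [N * B]; all three are
   absorbed modulo [N]. *)
have -> : (a2 %% N)%Z - (a1 %% N)%Z =
    (((a2 - a1) %/ (N * B))%Z * B - (a2 %/ N)%Z + (a1 %/ N)%Z) * N + d.
  have := divz_eq (a2 - a1) (N * B); rewrite -dE.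
  have := divz_eq a1 N; have := divz_eq a2 N; nia.
by rewrite modzMDl modz_id_upto.
Qed.

Lemma periodic_blocks (N B : int) (K : set int) : 1 <= N -> 1 <= B ->
  periodic_circular_sparse_ruler (N * B) N K ->
  K = [set m + b * N | m in K `&` int_upto N & b in int_upto B].
Proof.
move=> hN hB perK; have [_ subK transK _] := perK.
apply/seteqP; split=> [k Kk | _ [m [Km mN] [b bB <-]]].
  have rN := modz_int_upto N k hN.
  (* Euclidean division by [N] gives the position within a block and the block index. *)
  have kE : (k %% N)%Z + (k %/ N)%Z * N = k by rewrite addrC -divz_eq.
  exists (k %% N)%Z; first by split=> //; apply: periodic_modz perK Kk.
  exists (k %/ N)%Z => //.
  by apply/(int_upto_block N B _ _ rN); rewrite kE; apply: subK.
by apply: transK => //; apply/int_upto_block.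
Qed.

Lemma periodic_of_circular (N B : int) (M : set int) : 1 <= N -> 1 <= B ->
  circular_sparse_ruler N M ->
  periodic_circular_sparse_ruler (N * B) N
    [set m + b * N | m in M & b in int_upto B].
Proof.
move=> hN hB [subM /modular_difference_set_full fullM]; split.
- exact: dvdz_mulr.
- by move=> _ [m Mm [b bB <-]]; apply/int_upto_block => //; apply: subM.
- move=> _ [m Mm [b bB <-]] c; rewrite -addrA -mulrDl => bcNB.
  exists m => //; exists (b + c) => //.
  exact/(int_upto_block N B m (b + c) (subM _ Mm)).
apply/modular_difference_set_full; first by nia.
move=> d dNB.
have [m1 [m2 [Mm1 Mm2 dE]]] := fullM hN _ (modz_int_upto N d hN).
(* [d] and [m2 - m1] have the same remainder modulo [N], so they differ by [N] times the difference
   of their quotients. *)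
pose q := (d %/ N)%Z - ((m2 - m1) %/ N)%Z.
have dq : d = m2 - m1 + q * N.
  have := divz_eq d N; have := divz_eq (m2 - m1) N; rewrite /q mulrBl; lia.
(* [q] may fall outside [int_upto B]; replacing it by its remainder modulo [B] shifts the difference
   by a multiple of [N * B]. *)
exists m1, (m2 + (q %% B)%Z * N); split.
- by exists m1 => //; exists 0; [rewrite /int_upto /=; lia | rewrite mul0r addr0].
- by exists m2 => //; exists (q %% B)%Z => //; apply: modz_int_upto.
have -> : m2 + (q %% B)%Z * N - m1 = - (q %/ B)%Z * (N * B) + d.
  by rewrite dq {3}(divz_eq q B); ring.
by rewrite modzMDl modz_id_upto.
Qed.

Theorem theorem7 (N B : int) (hN : 1 <= N) (hB : 1 <= B) (K : set int) :
  periodic_circular_sparse_ruler (N * B) N K <->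
  exists M : set int,
    circular_sparse_ruler N M /\
    K = [set m + b * N | m in M & b in int_upto B].
Proof.
split=> [perK | [M [rulerM ->]]]; last exact: periodic_of_circular.
exists (K `&` int_upto N).
by split; [apply: circular_of_periodic perK | apply: periodic_blocks].
Qed.
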